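(* Let $q=p^k$ with $p$ an odd prime. Let $B,C\in\mathbb{F}_q$ with $C^2-C+1=0$, $B^3\neq -1$, and such that the polynomial $m_{B,C}(t)=Ct^3-B^2t^2-BCt-Bt-C\in\mathbb{F}_q[t]$ has no roots in $\mu_{q^2+q+1}$. Then $$f(x)=x^{q^2+q-1}+Bx^{q}+Cx$$ is a permutation polynomial of $\mathbb{F}_{q^3}$.
   Context: $\mu_{q^2+q+1}=\{x\in\mathbb{F}_{q^3}: x^{q^2+q+1}=1\}$. A polynomial $f\in\mathbb{F}_{q^3}[x]$ is a permutation polynomial of $\mathbb{F}_{q^3}$ if $c\mapsto f(c)$ is a bijection of $\mathbb{F}_{q^3}$. *)

(* Defs.v *)
From HB Require Import structures.
From mathcomp Require Export all_boot all_order all_algebra all_field.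

Set Implicit Arguments.
Unset Strict Implicit.
Unset Printing Implicit Defensive.

Import GRing.Theory.
Local Open Scope ring_scope.

Definition mu (F : finFieldType) (n : nat) : {set F} :=
  [set x : F | x ^+ n == 1].

Definition permutation_poly (F : finFieldType) (f : {poly F}) : Prop :=
  bijective (fun c : F => f.[c]).

Definition m_poly (K : fieldType) (B C : K) : {poly K} :=
  C *: 'X^3 - B ^+ 2 *: 'X^2 - (B * C) *: 'X - B *: 'X - C%:P.

Definition f_poly (F : fieldType) (q : nat) (B C : F) : {poly F} :=
  'X^(q ^ 2 + q - 1) + B *: 'X^q + C *: 'X.

(* Main.v *)
Require Import Defs.
From mathcomp Require Import ring.

Set Implicit Arguments.
Unset Strict Implicit.
Unset Printing Implicit Defensive.

Import GRing.Theory.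
Local Open Scope ring_scope.

(** Write [y = x^q], [z = x^(q^2)] and [c, c', c''] for the conjugates of
    [c = f(x)].  Then [x f(x) = c x] is the quadric
    [yz + Bxy + Cx^2 = cx], and its two conjugates are obtained by rotating
    [x, y, z] and [c, c', c''].  Because [C^2 - C + 1 = 0], the three quadratic
    forms on the left admit two independent linear syzygies.  Inserting
    [cx, c'y, c''z] into them gives two linear equations for [xy, xz, yz],
    which determine [x : y : z], hence [x], unless
    [c^2 + BCcc' - C^2c'c'' = 0].

    If [f(x) = 0] with [x != 0], then [y / x] is a root of [m_{B,C}] in [mu].
    If the determinant above vanishes with [c != 0], then
    [w = c / c' - (1 - C)B] satisfies [w^q = -(1 - C)(w + B)] and has norm [1],
    and [w^-1] is again a root of [m_{B,C}] in [mu]. *)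

(** Multiplying the quadrics by [z], [-Cx], [C^2 y] and adding leaves
    [(1 + C^3) y z^2 + B (1 - C + C^2) xyz], and both coefficients vanish. *)
Lemma syzygy_xz (F : fieldType) (B C x y z c c' c'' : F) :
    C ^+ 2 = C - 1 ->
    y * z + B * x * y + C * x ^+ 2 = c * x ->
    z * x + B * y * z + C * y ^+ 2 = c' * y ->
    x * y + B * z * x + C * z ^+ 2 = c'' * z ->
  c * (x * z) - C * c' * (x * y) + C ^+ 2 * c'' * (y * z) = 0.
Proof.
move=> hC e1 e2 e3.
have -> : c * (x * z) - C * c' * (x * y) + C ^+ 2 * c'' * (y * z) =
          z * (c * x) - C * x * (c' * y) + C ^+ 2 * y * (c'' * z) by ring.
by rewrite -e1 -e2 -e3; ring: hC.
Qed.

(** Here the multipliers are [y], [BCx + C^2 z], [-(Cx + BCy)]; again only multiples of [1 + C^3]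
    and [1 - C + C^2] survive. *)
Lemma syzygy_xy (F : fieldType) (B C x y z c c' c'' : F) :
    C ^+ 2 = C - 1 ->
    y * z + B * x * y + C * x ^+ 2 = c * x ->
    z * x + B * y * z + C * y ^+ 2 = c' * y ->
    x * y + B * z * x + C * z ^+ 2 = c'' * z ->
  (c + B * C * c') * (x * y) - C * c'' * (x * z)
    + (C ^+ 2 * c' - B * C * c'') * (y * z) = 0.
Proof.
move=> hC e1 e2 e3.
have -> : (c + B * C * c') * (x * y) - C * c'' * (x * z)
    + (C ^+ 2 * c' - B * C * c'') * (y * z) =
  y * (c * x) + (B * C * x + C ^+ 2 * z) * (c' * y)
    - (C * x + B * C * y) * (c'' * z) by ring.
by rewrite -e1 -e2 -e3; ring: hC.
Qed.

Lemma quadric_system_inj (F : fieldType)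
    (B C c c' c'' x y z x' y' z' : F) :
    C ^+ 2 = C - 1 -> c != 0 ->
    c ^+ 2 + B * C * c * c' - C ^+ 2 * c' * c'' != 0 ->
    x != 0 -> y != 0 -> z != 0 -> x' != 0 -> y' != 0 -> z' != 0 ->
    y * z + B * x * y + C * x ^+ 2 = c * x ->
    z * x + B * y * z + C * y ^+ 2 = c' * y ->
    x * y + B * z * x + C * z ^+ 2 = c'' * z ->
    y' * z' + B * x' * y' + C * x' ^+ 2 = c * x' ->
    z' * x' + B * y' * z' + C * y' ^+ 2 = c' * y' ->
    x' * y' + B * z' * x' + C * z' ^+ 2 = c'' * z' ->
  x = x'.
Proof.
move=> hC c0 D0 x0 y0 z0 x'0 y'0 z'0 e1 e2 e3 e1' e2' e3'.
have S := syzygy_xz hC e1 e2 e3; have T := syzygy_xy hC e1 e2 e3.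
have S' := syzygy_xz hC e1' e2' e3'; have T' := syzygy_xy hC e1' e2' e3'.
set D := _ - _ in D0.
set s := (X in X = 0) in S; set t := (X in X = 0) in T.
set s' := (X in X = 0) in S'; set t' := (X in X = 0) in T'.
(* Cramer's rule: this combination of the syzygies eliminates [xz] and leaves [D] in front of [xy];
   cross-multiplying by [y'z'] and [yz] removes the [yz] terms. *)
have hz : x * z' = x' * z.
  have yy0 : D * (y * y') != 0 by rewrite !mulf_neq0.
  apply: (mulfI yy0); apply/eqP; rewrite -subr_eq0; apply/eqP.
  transitivity (C * c'' * (s * (y' * z') - s' * (y * z))
              + c * (t * (y' * z') - t' * (y * z))).
    by rewrite /D /s /t /s' /t'; ring.
  by rewrite S T S' T' !(mul0r, mulr0, subr0, addr0).
(* Now [xy] is eliminated, and [D] stands in front of [xz]. *)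
have hy : x * y' = x' * y.
  have zz0 : D * (z * z') != 0 by rewrite !mulf_neq0.
  apply: (mulfI zz0); apply/eqP; rewrite -subr_eq0; apply/eqP.
  transitivity ((c + B * C * c') * (s * (y' * z') - s' * (y * z))
              + C * c' * (t * (y' * z') - t' * (y * z))).
    by rewrite /D /s /t /s' /t'; ring.
  by rewrite S T S' T' !(mul0r, mulr0, subr0, addr0).
(* The triples are proportional. The quadric has degree 2 and [cx] degree 1, so [c != 0] forces the
   ratio to be 1. *)
have k0 : c * x * x' != 0 by rewrite !mulf_neq0.
apply: (mulfI k0).
transitivity (x ^+ 2 * (c * x')); first by ring.
rewrite -e1'.
transitivity ((x * y') * (x * z') + B * x' * x * (x * y')
              + C * x ^+ 2 * x' ^+ 2); first by ring.
rewrite hy hz.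
transitivity (x' ^+ 2 * (c * x)); last by ring.
by rewrite -e1; ring.
Qed.

Lemma m_polyE (F : fieldType) (B C t : F) :
  (m_poly B C).[t] =
  C * t ^+ 3 - B ^+ 2 * t ^+ 2 - B * C * t - B * t - C.
Proof. by rewrite /m_poly !hornerE. Qed.

Lemma map_m_poly (K F : fieldType) (iota : {rmorphism K -> F}) (B C : K) :
  map_poly iota (m_poly B C) = m_poly (iota B) (iota C).
Proof.
by rewrite /m_poly !rmorphB /= !map_polyZ !map_polyXn map_polyX map_polyC
           rmorphXn rmorphM.
Qed.

Lemma root_m_poly_quadrics (F : fieldType) (B C x y z : F) :
    x != 0 ->
    y * z + B * x * y + C * x ^+ 2 = 0 ->
    z * x + B * y * z + C * y ^+ 2 = 0 ->
  root (m_poly B C) (y / x).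
Proof.
move=> x0 e1 e2; apply/rootP; rewrite m_polyE.
(* Both quadrics are linear in [z], with coefficients [x + By] and [y]; eliminating [z] leaves
   [x^3 m(y/x)]. *)
transitivity ((y * (z * x + B * y * z + C * y ^+ 2)
  - (x + B * y) * (y * z + B * x * y + C * x ^+ 2)) / x ^+ 3); first by field.
by rewrite e1 e2 !mulr0 subr0 mul0r.
Qed.

(** Since [C^2 e = BC], the recursion reads [b = C^2 (a - e)], [d = C^2 (b - e)], and it closes up
    as [a = C^2 (d - e)]. As [C^6 = 1], the shift preserves the product. *)
Lemma root_m_poly_shift (F : fieldType) (B C a b d : F) :
    C ^+ 2 = C - 1 ->
    b = C ^+ 2 * a - B * C -> d = C ^+ 2 * b - B * C -> a * b * d = 1 ->
  let e := (1 - C) * B in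
  (a - e) * (b - e) * (d - e) = 1 /\ root (m_poly B C) (a - e)^-1.
Proof.
move=> hC hb hd abd e.
have N : (a - e) * (b - e) * (d - e) = 1.
  by rewrite -abd hd hb /e; ring: hC.
split=> //; have w0 : a - e != 0.
  by apply: contra_eq_neq N => ->; rewrite !mul0r eq_sym oner_neq0.
apply/rootP; rewrite m_polyE; move: N w0.
have -> : b - e = - (1 - C) * (a - e + B) by rewrite hb /e; ring: hC.
have -> : d - e = - (1 - C) * (- (1 - C) * (a - e + B) + B).
  by rewrite hd hb /e; ring: hC.
move: (a - e) => w N w0.
(* Written in [w] alone, the norm condition is a cubic whose reciprocal polynomial is [m_poly] up to
   a constant. *)
transitivity (C * (1 - w * (- (1 - C) * (w + B))
      * (- (1 - C) * (- (1 - C) * (w + B) + B))) / w ^+ 3).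
  by field: hC.
by rewrite N subrr mulr0 mul0r.
Qed.

Lemma f_polyE (F : fieldType) (q : nat) (B C x : F) : (0 < q)%N ->
  (f_poly q B C).[x] * x =
  x ^+ q * (x ^+ q) ^+ q + B * x * x ^+ q + C * x ^+ 2.
Proof.
move=> q0; rewrite /f_poly !hornerE !mulrDl -exprSr -exprM.
have -> : (q ^ 2 + q - 1).+1 = (q + q * q)%N.
  by rewrite subn1 prednK ?addn_gt0 ?q0 ?orbT // addnC mulnn.
by rewrite exprD; congr (_ + _ + _); rewrite -!mulrA ?expr2 // (mulrC x).
Qed.

Lemma f_poly0 (F : fieldType) (q : nat) (B C : F) : (0 < q)%N ->
  (f_poly q B C).[0] = 0.
Proof.
move=> q0; rewrite /f_poly !hornerE !expr0n !gtn_eqF ?mulr0 ?addr0 //.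
by rewrite subn_gt0 (@leq_add 1 1) // expn_gt0 q0.
Qed.

Lemma f_poly_inj (F : fieldType) (q : nat) (B C : F) :
    (0 < q)%N ->
    (forall x y : F, (x + y) ^+ q = x ^+ q + y ^+ q) ->
    (forall x : F, ((x ^+ q) ^+ q) ^+ q = x) ->
    B ^+ q = B -> C ^+ q = C -> C ^+ 2 = C - 1 ->
    (forall t : F, t * t ^+ q * (t ^+ q) ^+ q = 1 -> ~~ root (m_poly B C) t) ->
  injective (fun x => (f_poly q B C).[x]).
Proof.
move=> q0 frobD frob3 hB hC C2 hm.
have frob_neq0 (x : F) : x != 0 -> x ^+ q != 0 by move=> x0; rewrite expf_neq0.
have frobB (x y : F) : (x - y) ^+ q = x ^+ q - y ^+ q.
  by apply/eqP; rewrite eq_sym subr_eq -frobD subrK.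
have frobQ (u v w : F) : (v * w + B * u * v + C * u ^+ 2) ^+ q =
    v ^+ q * w ^+ q + B * u ^+ q * v ^+ q + C * (u ^+ q) ^+ 2.
  by rewrite !frobD !exprMn hB hC.
have quadric x : let c := (f_poly q B C).[x] in
  let y := x ^+ q in let z := y ^+ q in
  [/\ y * z + B * x * y + C * x ^+ 2 = c * x,
      z * x + B * y * z + C * y ^+ 2 = c ^+ q * y &
      x * y + B * z * x + C * z ^+ 2 = (c ^+ q) ^+ q * z].
  move=> c y z; have e1 : y * z + B * x * y + C * x ^+ 2 = c * x.
    by rewrite /c f_polyE.
  have e2 : z * x + B * y * z + C * y ^+ 2 = c ^+ q * y.
    by rewrite -exprMn -e1 frobQ frob3.
  by split=> //; rewrite -exprMn -e2 frobQ frob3.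
have f_eq0 x : (f_poly q B C).[x] = 0 -> x = 0.
  move=> fx; apply/eqP; case: eqVneq => // x0.
  have [] := quadric x; rewrite fx !expr0n gtn_eqF //= !mul0r => e1 e2 _.
  (* The norm of [y / x] telescopes: [(y/x)(z/y)(x/z) = 1]. *)
  have := root_m_poly_quadrics x0 e1 e2; apply: contraLR => _; apply: hm.
  rewrite !expr_div_n frob3.
  by field; rewrite x0 !frob_neq0.
move=> x x' /= fxx'.
have [fx0|fx0] := eqVneq (f_poly q B C).[x] 0.
  by rewrite (f_eq0 x) // (f_eq0 x') // -fxx'.
have f0_neq0 u : (f_poly q B C).[u] != 0 -> u != 0.
  by apply: contra_neq => ->; rewrite f_poly0.
have x0 := f0_neq0 _ fx0; have x'0 : x' != 0 by rewrite f0_neq0 // -fxx'.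
have [e1 e2 e3] := quadric x.
have [] := quadric x'; rewrite -fxx' => e1' e2' e3'.
move: (f_poly q B C).[x] fx0 e1 e2 e3 e1' e2' e3' => c cn0 e1 e2 e3 e1' e2' e3'.
apply: (quadric_system_inj C2 cn0 _ _ _ _ _ _ _ e1 e2 e3 e1' e2' e3');
  rewrite ?frob_neq0 //.
apply/eqP => D0.
have c'0 := frob_neq0 _ cn0; have c''0 := frob_neq0 _ c'0.
(* Keeping [v] free lets the relation be conjugated twice. *)
have frobM (u v : F) :
    u ^+ 2 + B * C * u * u ^+ q - C ^+ 2 * u ^+ q * v = 0 ->
    (u ^+ q) ^+ 2 + B * C * u ^+ q * (u ^+ q) ^+ q
      - C ^+ 2 * (u ^+ q) ^+ q * v ^+ q = 0.
  move=> /(congr1 (fun a => a ^+ q)).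
  by rewrite frobB frobD !exprMn hB hC expr0n gtn_eqF.
have D1 := frobM _ _ D0; have D2 := frobM _ _ D1.
rewrite !frob3 in D1 D2.
move: D1 D2 => /eqP; rewrite subr_eq0 => /eqP D1 /eqP; rewrite subr_eq0 => /eqP D2.
(* Dividing [D1] by [c'c''] and [D2] by [c''c] gives the affine recursion for the ratios of
   consecutive conjugates, whose product is 1. *)
have [] := @root_m_poly_shift _ B C (c / c ^+ q) (c ^+ q / (c ^+ q) ^+ q)
  ((c ^+ q) ^+ q / c) C2.
- transitivity ((C ^+ 2 * (c ^+ q) ^+ q * c - B * C * c ^+ q * (c ^+ q) ^+ q)
                 / (c ^+ q * (c ^+ q) ^+ q)); last by field; rewrite c'0 c''0.
  by rewrite -D1; field; rewrite c'0 c''0.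
- transitivity ((C ^+ 2 * c * c ^+ q - B * C * (c ^+ q) ^+ q * c)
                 / ((c ^+ q) ^+ q * c)); last by field; rewrite cn0 c''0.
  by rewrite -D2; field; rewrite cn0 c''0.
- by field; rewrite cn0 c'0 c''0.
(* [e] is fixed by the [q]-th power map, so [N] is the norm of [w], and [w^-1] has norm 1 too. *)
set e := (1 - C) * B => N; apply/negP; apply: hm.
have he : e ^+ q = e by rewrite exprMn frobB expr1n hC hB.
by rewrite !exprVn !frobB !he !expr_div_n frob3 -!invfM N invr1.
Qed.

Lemma in_mu_norm (F : finFieldType) (q : nat) (t : F) :
  (t \in mu F (q ^ 2 + q + 1)%N) = (t * t ^+ q * (t ^+ q) ^+ q == 1).
Proof.
rewrite inE -exprM mulnn -[X in X * _ * _]expr1 -!exprD.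
by rewrite [in RHS]addnC (addnC 1%N) addnA.
Qed.

Theorem theorem3p5 (p k : nat) (p_prime : prime p) (p_odd : odd p)
    (k_gt0 : (0 < k)%N) (K F : finFieldType) (iota : {rmorphism K -> F})
    (cardK : #|K| = (p ^ k)%N) (cardF : #|F| = ((p ^ k) ^ 3)%N) (B C : K)
    (hC : C ^+ 2 - C + 1 = 0) (hB : B ^+ 3 != -1)
    (hm : forall t : F, t \in mu F ((p ^ k) ^ 2 + p ^ k + 1)%N ->
            ~~ root (map_poly iota (m_poly B C)) t) :
  permutation_poly (f_poly (p ^ k)%N (iota B) (iota C)).
Proof.
have q0 : (0 < p ^ k)%N by rewrite expn_gt0 prime_gt0.
have frobD (x y : F) :
    (x + y) ^+ (p ^ k) = x ^+ (p ^ k) + y ^+ (p ^ k).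
  rewrite exprDn_pchar // pnatX pnatE //; apply/orP; left.
  by apply: (@card_finPcharP _ p (k * 3)); rewrite // expnM.
have frob_iota (a : K) : iota a ^+ (p ^ k) = iota a.
  by rewrite -rmorphXn -cardK expf_card.
have C2 : iota C ^+ 2 = iota C - 1.
  have := congr1 iota hC.
  rewrite rmorphD rmorphB rmorphXn rmorph1 rmorph0 => {}hC.
  by rewrite -[LHS]subr0 -hC; ring.
apply: injF_bij; apply: f_poly_inj => //.
- by move=> x; rewrite -!exprM mulnn -expnS -cardF expf_card.
- by move=> t Nt; rewrite -map_m_poly hm // in_mu_norm Nt.
Qed.
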